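(* Let $T$ be a nonsingular real $n\times n$ matrix all of whose complex eigenvalues have modulus $<1$, let $D=\{d_1,\dots,d_q\}\subset\mathbb{R}^n$ be a finite set with $d_1=0$, and let $F$ be the unique nonempty compact subset of $\mathbb{R}^n$ satisfying $F=\bigcup_{j=1}^q T(F+d_j)$. Let $$U=\{c_{n_1}z_{2n_1},\,c_{n_2}z_{2n_2},\,\dots,\,c_{n_m}z_{2n_m}\}$$ be the set of all (complex) eigenvalues of $T^{-1}$ of the form $cz$ with $c>0$ real and $z\in\mathbb{C}$ a root of unity, where for each $1\le l\le m$ the number $c_{n_l}$ is a positive real, $n_l$ is a positive integer, and $z_{2n_l}\in\mathbb{C}$ satisfies $z_{2n_l}^{2n_l}=1$. Set $k=2n_1n_2\cdots n_m$. For each integer $i\ge 1$ let $\mathcal{V}_i$ be the set of vertices of the polytope $\mathcal{C}(A_i)$. If $\#\mathcal{V}_i\ne\#\mathcal{V}_{i+1}$ for all $1\le i\le k$, then $\mathcal{C}(F)$ is not a polytope. Therefore, $\mathcal{C}(F)$ is a polytope if and only if $\#\mathcal{V}_i=\#\mathcal{V}_{i+1}$ for some $1\le i\le k$.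
   Context: For $S\subset\mathbb{R}^n$, $\mathcal{C}(S)$ denotes the convex hull of $S$, and $\#S$ denotes the cardinality of $S$. For each integer $i\ge1$, $$A_i=\Big\{\sum_{s=1}^{i}T^{s}d_{j_s}\ :\ d_{j_1},\dots,d_{j_i}\in D\Big\},$$ which is a finite set. Equivalently, $A_i$ is the set of images of $0$ under all $i$-fold compositions of the maps $\phi_j(x)=T(x+d_j)$, $1\le j\le q$. A polytope is the convex hull of a finite set of points (not required to have nonempty interior), and its vertices are its extreme points. The roots of unity $z_{2n_l}$ are not required to be primitive $2n_l$-th roots of unity. An empty product equals $1$, so $k=2$ if $U=\emptyset$. The matrix $T$ is not assumed to be a similitude. *)

(* Defs.v *)
From HB Require Import structures.
From mathcomp Require Import all_boot all_order all_algebra.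
From mathcomp Require Import complex.
From mathcomp Require Import all_classical all_reals all_analysis.

Set Implicit Arguments.
Unset Strict Implicit.
Unset Printing Implicit Defensive.

Import Order.TTheory GRing.Theory Num.Theory.

Local Open Scope classical_set_scope.
Local Open Scope ring_scope.
Local Open Scope complex_scope.

Section Convexity.
Context {R : realType} {E : lmodType R}.
Implicit Types S K : set E.

Definition convex_hull S : set E := smallest (@convex_set R E) S.

Definition extreme_points K : set E :=
  [set x | K x /\ forall (y z : E) (t : R), K y -> K z -> 0 < t -> t < 1 ->
             x = t *: y + (1 - t) *: z -> y = x /\ z = x].

Definition polytope K : Prop :=
  exists2 S : set E, finite_set S & K = convex_hull S.

End Convexity.

Section SelfAffine.
Context {R : realType} {n : nat}.
Implicit Types (T : 'M[R]_n) (D : set 'cV[R]_n).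

(* Only d 1, ..., d i matter. *)
Definition digit_sums T D (i : nat) : set 'cV[R]_n :=
  [set x | exists2 d : nat -> 'cV[R]_n, (forall s, D (d s)) &
             x = \sum_(1 <= s < i.+1) T ^+ s *m d s].

Definition hull_vertices T D (i : nat) : set 'cV[R]_n :=
  extreme_points (convex_hull (digit_sums T D i)).

(* [eigenvalue] is stated with row eigenvectors; the spectrum is the same. *)
Definition complex_eigenvalues T : set R[i] :=
  [set a | eigenvalue (map_mx (real_complex R) T) a].

Definition root_of_unity (z : R[i]) : Prop :=
  exists2 N : nat, (0 < N)%N & z ^+ N = 1.

(* The eigenvalues c z with c > 0 real and z a root of unity. *)
Definition rational_angle_eigenvalues T : set R[i] :=
  [set u | complex_eigenvalues T u /\
           exists (c : R) (z : R[i]), [/\ 0 < c, root_of_unity z & u = c%:C * z]].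

End SelfAffine.

(* Main.v *)
Require Import Defs.
From mathcomp Require Import all_boot all_order all_algebra.
From mathcomp Require Import separable complex finmap.
From mathcomp Require Import all_classical all_reals all_analysis.
From mathcomp Require Import ring lra.

(** Write [Q] for the hull of [D], so that the hull of [A_i] is the Minkowski sum
    [T Q + ... + T^i Q] and the hull of [F] is the infinite sum. A Minkowski sum
    has for normal fan the common refinement of the fans of its summands. So
    each vertex of the hull of [A_i] extends to a vertex of the hull of
    [A_(i+1)], and the numbers of vertices agree exactly when the fan of [A_i]
    refines that of [T^(i+1) D] ([refines_card]). Everything is expressed by
    finite sets and the linear functionals that are maximal at one of their
    points only; such points are the vertices ([extreme_points_convex_hull]).

    If the numbers agree once, they agree forever, because
    [A_(i+1) = T D + T A_i] ([digit_sums_refines]). A functional exposing a vertex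
    [a] of [A_i] then exposes in every later [A_j] a point that depends on [a]
    only. As the powers of [T] tend to [0], these points accumulate at a point of
    [F] where all functionals exposing [a] are maximal on [F], and finitely many
    such points span the hull of [F] ([stable_hull_polytope]).

    Conversely, let the hull of [F] be the hull of a finite set [S]. Every
    [T^j Q] with [j > 0] is a summand of it, so each edge of [T^j Q] is parallel
    to a difference of two points of [S] ([edge_of_summand]). By the pigeonhole
    principle, the direction [u] of an edge of [Q] satisfies [T^p u = l u] for
    some [p > 0] and real [l <> 0]. Then [u] is a sum of eigenvectors of
    [T^-1] for eigenvalues of the form [r z], with one [r > 0] and with roots of
    unity [z] such that [z^k = 1]; hence [T^k u = r^(-k) u]
    ([periodic_direction]). Thus [T^k] multiplies every edge of [Q] by a positive
    number. As the cone of [Q] at a vertex is spanned by the edges there,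
    [T^k Q] has the same normal fan as [Q] ([refines_fixed_edges]), so the fan of
    the summand [T D] of [A_k] already refines that of [T^(k+1) D], and the
    numbers of vertices agree at [i = k]. *)

Set Implicit Arguments.
Unset Strict Implicit.
Unset Printing Implicit Defensive.

Import Order.TTheory GRing.Theory Num.Theory.
Import numFieldNormedType.Exports.

Local Open Scope classical_set_scope.
Local Open Scope ring_scope.
Local Open Scope complex_scope.
Local Open Scope card_scope.

(** * Linear functionals and finitely generated cones *)

Section Functionals.
Context {R : realType} {n : nat}.
Implicit Types (f g : 'rV[R]_n) (u v w x y : 'cV[R]_n) (s : seq 'cV[R]_n).

Definition dot f x : R := (f *m x) 0 0.

Lemma dotDr f x y : dot f (x + y) = dot f x + dot f y.
Proof. by rewrite /dot mulmxDr mxE. Qed.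

Lemma dotBr f x y : dot f (x - y) = dot f x - dot f y.
Proof. by rewrite /dot mulmxBr !mxE. Qed.

Lemma dotZr f a x : dot f (a *: x) = a * dot f x.
Proof. by rewrite /dot -scalemxAr mxE. Qed.

Lemma dotNr f x : dot f (- x) = - dot f x.
Proof. by rewrite /dot mulmxN mxE. Qed.

Lemma dot0r f : dot f 0 = 0.
Proof. by rewrite /dot mulmx0 mxE. Qed.

Lemma dotDl f g x : dot (f + g) x = dot f x + dot g x.
Proof. by rewrite /dot mulmxDl mxE. Qed.

Lemma dotNl f x : dot (- f) x = - dot f x.
Proof. by rewrite /dot mulNmx mxE. Qed.

Lemma dotZl a f x : dot (a *: f) x = a * dot f x.
Proof. by rewrite /dot -scalemxAl mxE. Qed.

Lemma dot_mulmx f (M : 'M[R]_n) x : dot (f *m M) x = dot f (M *m x).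
Proof. by rewrite /dot mulmxA. Qed.

Definition dotE := (dotDr, dotBr, dotZr, dotNr, dot0r, dotDl, dotNl, dotZl).

Lemma dot_slide f g w x : dot g (x - (dot f x / dot f w) *: w) =
  dot (g - (dot g w / dot f w) *: f) x.
Proof. by rewrite !dotE mulrAC [dot g w / _ * _]mulrAC [dot f x * _]mulrC. Qed.

Lemma dot_separates_line u w :
  ~ (exists t, w = t *: u) -> exists2 g, dot g u = 0 & 0 < dot g w.
Proof.
move=> wNu; have: ~~ (w^T <= u^T)%MS.
  apply/negP => /sub_rVP[t tE]; apply: wNu; exists t.
  by apply: trmx_inj; rewrite tE linearZ.
rewrite submxE => /matrix0Pn[i [j]]; rewrite (ord1 i) => wj.
pose g : 'rV[R]_n := (col j (cokermx u^T))^T.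
have gE x : dot g x = (x^T *m cokermx u^T) 0 j.
  by rewrite /dot !mxE; apply: eq_bigr => k _; rewrite !mxE mulrC.
have gu : dot g u = 0 by rewrite gE mulmx_coker mxE.
have gw : dot g w != 0 by rewrite gE.
case: (ltrgt0P (dot g w)) gw => // gw0 _; first by exists g.
by exists (- g); rewrite ?dotNl ?gu ?oppr0 // oppr_gt0.
Qed.

Lemma positivity_stable s f g : (forall w, w \in s -> 0 < dot f w) ->
  exists2 e : R, 0 < e & forall d : R, 0 < d -> d <= e ->
    forall w, w \in s -> 0 < dot (f + d *: g) w.
Proof.
elim: s => [|w s IH] fs; first by exists 1.
have [|e e0 es] := IH; first by move=> v vs; apply: fs; rewrite inE vs orbT.
have fw : 0 < dot f w by apply: fs; rewrite mem_head.
pose a := `|dot g w| + 1.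
have a0 : 0 < a by rewrite ltr_wpDl.
exists (Num.min e (dot f w / a)); first by rewrite lt_min e0 divr_gt0.
move=> d d0; rewrite le_min => /andP[de da] v.
rewrite inE => /predU1P[->|vs]; last exact: es.
rewrite dotDl dotZl; rewrite ler_pdivlMr // in da.
have := ler_norm (- dot g w); rewrite normrN => gw.
by rewrite /a in da; nra.
Qed.

(** Induction over the hyperplanes to avoid: a small perturbation inside the
    functionals vanishing on [u] leaves the next one, and the sign acquired there
    joins the positivity conditions, so that later perturbations preserve it. *)
Lemma generic_functional u s s' f : dot f u = 0 ->
  (forall w, w \in s -> 0 < dot f w) ->
  exists g, [/\ dot g u = 0, forall w, w \in s -> 0 < dot g w &
    forall w, w \in s' -> dot g w != 0 \/ exists t, w = t *: u].
Proof.
elim: s' s f => [|w s' IH] s f fu fs; first by exists f.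
have [[t wE]|wNu] := pselect (exists t, w = t *: u).
  have [g [gu gs gs']] := IH s f fu fs.
  exists g; split=> // v; rewrite inE => /predU1P[->|]; last exact: gs'.
  by right; exists t.
have [h [hu hs hw]] : exists h, [/\ dot h u = 0,
    forall v, v \in s -> 0 < dot h v & dot h w != 0].
  have [fw|fw] := eqVneq (dot f w) 0; last by exists f.
  have [g gu gw] := dot_separates_line wNu.
  have [e e0 es] := positivity_stable g fs.
  exists (f + e *: g); split; first by rewrite !dotE fu gu mulr0 addr0.
    exact: es.
  by rewrite !dotE fw add0r mulf_neq0 // gt_eqF.
pose w' := dot h w *: w.
have [|g [gu gs gs']] := IH (w' :: s) h hu.
  move=> v; rewrite inE => /predU1P[->|]; last exact: hs.
  by rewrite /w' dotZr -expr2 exprn_even_gt0.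
exists g; split=> // v; first by move=> vs; apply: gs; rewrite inE vs orbT.
rewrite inE => /predU1P[->|]; last exact: gs'.
left; have := gs w'; rewrite mem_head dotZr => /(_ isT).
by case: eqP => // ->; rewrite mulr0 ltxx.
Qed.

Definition is_cone (C : set 'cV[R]_n) : Prop :=
  [/\ C 0, forall x y, C x -> C y -> C (x + y) &
      forall a x, 0 <= a -> C x -> C (a *: x)].

Definition cone s : set 'cV[R]_n := smallest is_cone [set` s].

Lemma cone_is_cone s : is_cone (cone s).
Proof.
split=> [C [[]] //|x y xs ys C Cs|a x a0 xs C Cs].
  by have [[_ CD _] _] := Cs; apply: CD; [exact: xs|exact: ys].
by have [[_ _ CZ] _] := Cs; apply: CZ => //; exact: xs.
Qed.

Lemma cone0 s : cone s 0. Proof. by have [] := cone_is_cone s. Qed.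

Lemma coneD s x y : cone s x -> cone s y -> cone s (x + y).
Proof. by have [_ + _] := cone_is_cone s; exact. Qed.

Lemma coneZ s a x : 0 <= a -> cone s x -> cone s (a *: x).
Proof. by have [_ _] := cone_is_cone s; exact. Qed.

Lemma mem_cone s x : x \in s -> cone s x.
Proof. by move=> xs C [_]; exact. Qed.

Lemma cone_sub s (C : set 'cV[R]_n) : is_cone C ->
  (forall x, x \in s -> C x) -> cone s `<=` C.
Proof. by move=> CC sC; apply: smallest_sub. Qed.

Lemma cone_trans s s' : (forall x, x \in s -> cone s' x) -> cone s `<=` cone s'.
Proof. by move=> ss'; apply: cone_sub ss'; exact: cone_is_cone. Qed.

(** Gordan's alternative, by induction on the number of vectors. A functional
    positive on all vectors but [w] is kept, perturbed, or, when it is negative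
    on [w], used to slide the others along [w] into its kernel. *)
Theorem gordan s : (exists f, forall x, x \in s -> 0 < dot f x) \/
  (exists2 x, x \in s & cone s (- x)).
Proof.
have [k ks] := ubnP (size s); elim: k s ks => // k IH [|w s] /= ks.
  by left; exists 0.
have sub_cone : cone s `<=` cone (w :: s).
  by apply: cone_trans => x xs; apply: mem_cone; rewrite inE xs orbT.
have [[f fs]|[x xs sx]] := IH s ks; last first.
  by right; exists x; [rewrite inE xs orbT|exact: sub_cone].
have [->|w0] := eqVneq w 0.
  by right; exists 0; rewrite ?mem_head // oppr0; exact: cone0.
have [fw|fw|fw] := ltrgt0P (dot f w).
- by left; exists f => x; rewrite inE => /predU1P[->|/fs].
- pose y x := x - (dot f x / dot f w) *: w.
  have fy x : dot f (y x) = 0.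
    by rewrite /y !dotE divfK ?subrr // lt_eqF.
  have [|[g gs]|[_ /mapP[x xs ->] yx]] := IH (map y s); first by rewrite size_map.
    pose h := g - (dot g w / dot f w) *: f.
    have hw : dot h w = 0 by rewrite /h !dotE divfK ?subrr // lt_eqF.
    have hs x : x \in s -> 0 < dot h x.
      by move=> xs; rewrite -dot_slide; exact: gs (map_f y xs).
    have [e e0 es] := positivity_stable (- f) hs.
    left; exists (h + e *: - f) => x; rewrite inE => /predU1P[->|]; last exact: es.
    by rewrite dotDl hw add0r dotZl dotNl mulr_gt0 // oppr_gt0.
  have wc : cone (w :: s) w by apply: mem_cone; rewrite mem_head.
  have c0 z : z \in s -> 0 <= - (dot f z / dot f w).
    by move=> zs; rewrite -mulrN -invrN divr_ge0 ?ltW ?fs // oppr_gt0.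
  right; exists x; first by rewrite inE xs orbT.
  have -> : - x = - y x + (- (dot f x / dot f w)) *: w.
    by rewrite /y opprB scaleNr addrAC subrr add0r.
  apply: coneD; last by apply: coneZ => //; exact: c0.
  apply: cone_trans yx => _ /mapP[z zs ->]; rewrite /y -scaleNr.
  by apply: coneD; [exact: sub_cone (mem_cone zs)|apply: coneZ => //; exact: c0].
- have [|g _ gw] := @dot_separates_line 0 w.
    by case=> t; rewrite scaler0; exact/eqP.
  have [e e0 es] := positivity_stable g fs.
  left; exists (f + e *: g) => x; rewrite inE => /predU1P[->|]; last exact: es.
  by rewrite !dotE fw add0r mulr_gt0.
Qed.

Lemma irredundant_generators s : exists s', [/\ {subset s' <= s},
  cone s `<=` cone s' & forall u, u \in s' -> ~ cone [seq x <- s' | x != u] u].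
Proof.
have [k ks] := ubnP (size s); elim: k s ks => // k IH s; rewrite ltnS => ks.
have [[u us cu]|Nu] :=
    pselect (exists2 u, u \in s & cone [seq x <- s | x != u] u); last first.
  by exists s; split=> // u us cu; apply: Nu; exists u.
have [|s' [s's ss' irr]] := IH [seq x <- s | x != u].
  apply: leq_trans ks; rewrite size_filter -(count_predC (predC1 u) s).
  rewrite -[ltnLHS]addn0 ltn_add2l -has_count; apply/hasP; exists u => //=.
  by rewrite eqxx.
exists s'; split=> // [x /s's|x]; first by rewrite mem_filter => /andP[].
move=> sx; apply: ss'; move: x sx; apply: cone_trans => y ys.
have [->//|yu] := eqVneq y u.
by apply: mem_cone; rewrite mem_filter /= yu.
Qed.

(** [f0] supports the cone exactly along the ray spanned by [u]: it comes from
    Gordan's alternative applied to the projections of the other generators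
    along [u], where a dependence would express [u] by the other generators. *)
Lemma supporting_functional_of_ray s f u : (forall x, x \in s -> 0 < dot f x) ->
  u \in s -> ~ cone [seq x <- s | x != u] u ->
  exists2 f0, dot f0 u = 0 &
    forall x, cone s x -> 0 < dot f0 x \/ exists t, x = t *: u.
Proof.
move=> fs us; set s' := [seq x <- s | x != u] => uNs'.
have fu := fs u us.
have s's x : x \in s' -> x \in s by rewrite mem_filter => /andP[].
pose y x := x - (dot f x / dot f u) *: u.
have [[g gs]|[_ /mapP[x xs ->] yx]] := gordan (map y s').
  pose h := g - (dot g u / dot f u) *: f.
  have hu : dot h u = 0 by rewrite /h !dotE divfK ?subrr // gt_eqF.
  have hs x : x \in s' -> 0 < dot h x.
    by move=> xs; rewrite -dot_slide; exact: gs (map_f y xs).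
  pose C x := 0 < dot h x \/ exists2 t, 0 <= t & x = t *: u.
  have CC : is_cone C.
    split=> [|v w|a v a0].
    - by right; exists 0; rewrite ?scale0r.
    - move=> [hv|[t t0 ->]] [hw|[r r0 ->]]; rewrite /C dotDr ?dotZr ?hu ?mulr0;
        [left|left|left|right]; rewrite ?addr0 ?add0r //; first exact: addr_gt0.
      by exists (t + r); rewrite ?addr_ge0 // scalerDl.
    - case=> [hv|[t t0 ->]]; last first.
        by right; exists (a * t); rewrite ?mulr_ge0 // scalerA.
      have [->|aN0] := eqVneq a 0; first by right; exists 0; rewrite ?scale0r.
      by left; rewrite dotZr mulr_gt0 // lt_def aN0.
  exists h => // x /(cone_sub CC)[z zs|hx|[t _ xE]]; [|by left|by right; exists t].
  have [->|zu] := eqVneq z u; first by right; exists 1; rewrite ?scale1r.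
  by left; apply: hs; rewrite mem_filter zu.
pose C v := exists2 t, 0 <= t & cone s' (v + t *: u).
have CC : is_cone C.
  split=> [|v w [t t0 vt] [r r0 wr]|a v a0 [t t0 vt]].
  - by exists 0; rewrite // scale0r addr0; exact: cone0.
  - exists (t + r); first exact: addr_ge0.
    by rewrite scalerDl addrACA; exact: coneD.
  - by exists (a * t); rewrite ?mulr_ge0 // -scalerA -scalerDr; exact: coneZ.
have [|t t0 ct] := cone_sub CC _ yx.
  move=> _ /mapP[z zs ->]; exists (dot f z / dot f u).
    by rewrite divr_ge0 ?ltW // fs // s's.
  by rewrite subrK; exact: mem_cone.
case: uNs'; set r := dot f x / dot f u in ct.
have tr : 0 < r + t by rewrite ltr_pwDl // divr_gt0 // fs // s's.
have -> : u = (r + t)^-1 *: (x + (- y x + t *: u)).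
  rewrite /y -/r opprB addrA addrCA subrr addr0 -scalerDl scalerA mulVf ?scale1r //.
  by rewrite gt_eqF.
apply: coneZ; first by rewrite invr_ge0 ltW.
by apply: coneD => //; exact: mem_cone.
Qed.

End Functionals.

(** * Exposed points of finite sets and their convex hulls *)

Lemma convex_setP (R : realType) (E : lmodType R) (B : set E) :
  @convex_set R E B <-> forall x y t, B x -> B y -> 0 <= t -> t <= 1 ->
    B (t *: x + (1 - t) *: y).
Proof.
split=> [BC x y t Bx By t0 t1|BC x y l].
  have := BC x y (Itv01 t0 t1); rewrite !inE; exact.
by rewrite !inE => Bx By; apply: BC.
Qed.

Section Hulls.
Context {R : realType} {E : lmodType R}.
Implicit Types A B : set E.

Lemma convex_hull_convex A : @convex_set R E (convex_hull A).
Proof.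
apply/convex_setP => x y t Ax Ay t0 t1 C [/[dup] CC /convex_setP Ct AC].
by apply: Ct => //; [exact: Ax|exact: Ay].
Qed.

Lemma sub_convex_hull A : A `<=` convex_hull A.
Proof. exact: sub_gen_smallest. Qed.

Lemma convex_hull_sub A B : @convex_set R E B -> A `<=` B -> convex_hull A `<=` B.
Proof. exact: smallest_sub. Qed.

Lemma convex_hull_minus_extreme A x : extreme_points (convex_hull A) x ->
  @convex_set R E (convex_hull A `\ x).
Proof.
move=> [hx xE]; apply/convex_setP => y z t [hy yx] [hz zx] t0 t1; split.
  by have /convex_setP := @convex_hull_convex A; exact.
move: t0 t1; rewrite !le_eqVlt => /predU1P[<- _|t0 /predU1P[->|t1]].
- by rewrite scale0r add0r subr0 scale1r.
- by rewrite scale1r subrr scale0r addr0.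
by move=> /esym/(xE _ _ _ hy hz t0 t1)[].
Qed.

Lemma extreme_points_sub A : extreme_points (convex_hull A) `<=` A.
Proof.
move=> x xE; apply: contrapT => Ax.
have Bconv := convex_hull_minus_extreme xE.
have /(_ A _ x)[||_ []//] := convex_hull_sub Bconv; last by case: xE.
move=> y Ay; split; first exact: sub_convex_hull.
by move=> /= yx; rewrite yx in Ay.
Qed.

End Hulls.

Section ExposedPoints.
Context {R : realType} {n : nat}.
Implicit Types (f g : 'rV[R]_n) (a b x y : 'cV[R]_n) (s : seq 'cV[R]_n).
Implicit Types A B C : set 'cV[R]_n.

(** A point outside a convex set is strictly separated from finitely many of its
    points: the convex set spans a cone at [x] that contains no opposite of its
    own generators, so that Gordan's alternative produces the functional. *)
Lemma separation s B x : @convex_set R _ B -> (forall y, y \in s -> B y) ->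
  ~ B x -> exists f, forall y, y \in s -> dot f y < dot f x.
Proof.
move=> /convex_setP BC sB Bx.
have [[f fs]|[_ /mapP[y ys ->] cy]] := gordan [seq x - y | y <- s].
  by exists f => y ys; rewrite -subr_gt0 -dotBr; apply/fs/map_f.
have By := sB y ys.
pose K v := exists t, exists2 b, B b & 0 <= t /\ v = t *: (x - b).
have KC : is_cone K.
  split=> [|v w [t [b Bb [t0 ->]]] [r [c Bc [r0 ->]]]|c v c0 [t [b Bb [t0 ->]]]].
  - by exists 0, y => //; rewrite scale0r.
  - have [tr|] := eqVneq (t + r) 0.
      have [-> ->] : t = 0 /\ r = 0 by split; lra.
      by exists 0, b => //; rewrite !scale0r addr0.
    move=> tr; have tr0 : 0 < t + r by rewrite lt_def tr addr_ge0.
    exists (t + r), (t / (t + r) *: b + (1 - t / (t + r)) *: c).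
      apply: BC => //; first by rewrite divr_ge0 // ltW.
      by rewrite ler_pdivrMr // mul1r lerDl.
    split; first exact: ltW.
    by apply/colP => i; rewrite !mxE; field.
  - by exists (c * t), b => //; rewrite mulr_ge0 // scalerA.
have [|t [b Bb [t0 yxb]]] := cone_sub KC _ cy.
  move=> _ /mapP[z zs ->]; exists 1, z; first exact: sB.
  by rewrite scale1r.
have t1 : 0 < 1 + t by rewrite ltr_wpDr.
case: Bx; have -> : x = (1 + t)^-1 *: y + (1 - (1 + t)^-1) *: b.
  have tx : (1 + t) *: x = y + t *: b.
    rewrite scalerDl scale1r -[t *: x](subrK (t *: b)) -scalerBr -yxb.
    by rewrite opprB addrA addrCA subrr addr0.
  apply: (scalerI (lt0r_neq0 t1)); rewrite tx.
  by apply/colP => i; rewrite !mxE; field; exact: lt0r_neq0.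
apply: BC => //; first by rewrite invr_ge0 ltW.
by rewrite invf_le1 // lerDl.
Qed.

Definition exposes f A a := A a /\ forall x, A x -> x <> a -> dot f x < dot f a.

Definition exposed A : set 'cV[R]_n := [set a | exists f, exposes f A a].

Lemma exposes_exposed f A a : exposes f A a -> exposed A a.
Proof. by exists f. Qed.

Lemma exposes_le f A a x : exposes f A a -> A x -> dot f x <= dot f a.
Proof.
by move=> [_ fA] Ax; have [->//|/eqP xa] := eqVneq x a; apply/ltW/fA.
Qed.

Lemma exposes_unique f A a b : exposes f A a -> exposes f A b -> a = b.
Proof.
move=> fa [Ab fb]; apply: contrapT => ab.
by have := fb a fa.1 ab; rewrite ltNge (exposes_le fa Ab).
Qed.

Lemma exposed_sub A : exposed A `<=` A. Proof. by move=> a [f []]. Qed.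

Lemma convex_hull_le f A a x : (forall y, A y -> dot f y <= dot f a) ->
  convex_hull A x -> dot f x <= dot f a.
Proof.
move=> fa; apply: (@convex_hull_sub _ _ A [set x | dot f x <= dot f a]) => //.
apply/convex_setP => y z t /= fy fz t0 t1; rewrite !dotE; nra.
Qed.

Lemma convex_hull_exposes f A a x : exposes f A a -> convex_hull A x ->
  x <> a -> dot f x < dot f a.
Proof.
move=> fa; have fle := exposes_le fa.
suff H : convex_hull A `<=` [set x | x = a \/ dot f x < dot f a].
  by move=> /H[].
apply: convex_hull_sub; last first.
  move=> y Ay; have [->|/eqP ya] := eqVneq y a; first by left.
  by right; apply: fa.2.
apply/convex_setP => y z t /= Hy Hz t0 t1.
have yle : dot f y <= dot f a by case: Hy => [->//|/ltW].
have zle : dot f z <= dot f a by case: Hz => [->//|/ltW].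
have [t00|t00] := eqVneq t 0.
  by rewrite t00 scale0r add0r subr0 scale1r.
have [t11|t11] := eqVneq t 1.
  by rewrite t11 subrr scale0r addr0 scale1r.
have {}t0 : 0 < t by rewrite lt_def t00.
have {}t1 : t < 1 by rewrite lt_def eq_sym t11.
rewrite !dotE.
case: Hy => [->|Hy]; last by right; nra.
case: Hz => [->|Hz]; last by right; nra.
by left; rewrite -scalerDl addrC subrK scale1r.
Qed.

(** An extreme point [x] is exposed because removing it leaves a convex set that
    contains the other points of [A], from which a functional separates [x]. *)
Lemma extreme_points_convex_hull A : finite_set A ->
  extreme_points (convex_hull A) = exposed A.
Proof.
move=> /finite_seqP[s sA]; apply/seteqP; split=> x.
  move=> xE; have Ax := extreme_points_sub xE.
  have [f fs] : exists f, forall y, y \in [seq y <- s | y != x] -> dot f y < dot f x.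
    apply: separation (convex_hull_minus_extreme xE) _ _ => [y|[_ /(_ erefl)]//].
    rewrite mem_filter => /andP[/eqP yx ys]; split=> //.
    by apply: sub_convex_hull; rewrite sA.
  exists f; split=> // y; rewrite sA /= => ys /eqP yx.
  by apply: fs; rewrite mem_filter yx.
case=> f fx; split; first by apply: sub_convex_hull; case: fx.
move=> y z t hy hz t0 t1 xE.
have H := convex_hull_exposes fx.
have yx : dot f y <= dot f x.
  by have [->//|/eqP/(H _ hy)/ltW] := eqVneq y x.
have zx : dot f z <= dot f x.
  by have [->//|/eqP/(H _ hz)/ltW] := eqVneq z x.
have := congr1 (dot f) xE; rewrite !dotE => fE.
by clear sA; split; apply: contrapT; [move=> /(H _ hy)|move=> /(H _ hz)] => ?; nra.
Qed.

Lemma finite_exposed A : finite_set A -> finite_set (exposed A).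
Proof. by apply: sub_finite_set; exact: exposed_sub. Qed.

Lemma argmax_dot f s : s != [::] ->
  exists2 a, a \in s & forall x, x \in s -> dot f x <= dot f a.
Proof.
elim: s => // x [_ _|y s IH _].
  by exists x; rewrite ?mem_head // => y; rewrite inE => /eqP ->.
have [//|a ays amax] := IH; have [xa|ax] := leP (dot f x) (dot f a).
  by exists a => [|z]; rewrite inE ?ays ?orbT // => /predU1P[->//|/amax].
exists x => [|z]; rewrite inE ?eqxx // => /predU1P[->//|/amax za].
exact: le_trans za (ltW ax).
Qed.

(** A functional that is injective on a finite set exposes its maximum there, and
    such functionals are generic. *)
Lemma expose_nearby f s A : (forall w, w \in s -> 0 < dot f w) ->
  finite_set A -> A !=set0 ->
  exists2 g, (forall w, w \in s -> 0 < dot g w) & exists a, exposes g A a.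
Proof.
move=> fs /finite_seqP[r rA] [a0 Aa0].
have [g [_ gs gr]] := generic_functional [seq x - y | x <- r, y <- r] (dot0r f) fs.
exists g => //; have [|a ar amax] := argmax_dot g (s := r).
  by move: Aa0; rewrite rA /=; case: (r).
exists a; split; first by rewrite rA.
move=> x; rewrite rA /= => xr xa.
rewrite lt_def amax // andbT eq_sym -subr_eq0 -dotBr.
have [|//|[t]] := gr (x - a).
  by apply/allpairsP; exists (x, a).
by rewrite scaler0 => /eqP; rewrite subr_eq0 => /eqP.
Qed.

End ExposedPoints.

(** * Vertices of Minkowski sums *)

Section MinkowskiSums.
Context {R : realType} {n : nat}.
Implicit Types (f g : 'rV[R]_n) (a b x y : 'cV[R]_n) (s : seq 'cV[R]_n) (M : 'M[R]_n).
Implicit Types A B C : set 'cV[R]_n.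

Definition minkowski A B : set 'cV[R]_n := [set a + b | a in A & b in B].

Lemma minkowskiC A B : minkowski A B = minkowski B A.
Proof.
by apply/seteqP; split=> _ [a Aa [b Bb <-]]; exists b => //; exists a;
  rewrite // addrC.
Qed.

Lemma finite_minkowski A B : finite_set A -> finite_set B ->
  finite_set (minkowski A B).
Proof. exact: finite_image2. Qed.

Lemma exposes_minkowski f A B a b : A a -> B b ->
  exposes f (minkowski A B) (a + b) <-> exposes f A a /\ exposes f B b.
Proof.
move=> Aa Bb; split=> [[_ fab]|[fa fb]].
  split; split=> // x Hx xN.
  - suff: dot f (x + b) < dot f (a + b) by rewrite !dotE ltrD2r.
    by apply: fab => [|/addIr//]; exists x => //; exists b.
  - suff: dot f (a + x) < dot f (a + b) by rewrite !dotE ltrD2l.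
    by apply: fab => [|/addrI//]; exists a => //; exists x.
split; first by exists a => //; exists b.
move=> _ [x Ax [y By <-]] xyab; rewrite !dotE.
have [xa|/eqP xa] := eqVneq x a.
  rewrite xa ltrD2l; apply: fb.2 => // yb; apply: xyab; congr (_ + _) => //.
by apply: ltr_leD; [exact: fa.2|exact: exposes_le fb By].
Qed.

(** Every cone of the normal fan of the hull of [A] lies in a cone of the normal
    fan of the hull of [B]; it is enough to say it of the open cones. *)
Definition refines A B : Prop := forall a, exposed A a ->
  exists b, forall f, exposes f A a -> exposes f B b.

Lemma refines_refl A : refines A A.
Proof. by move=> a _; exists a. Qed.

Lemma refines_trans A B C : refines A B -> refines B C -> refines A C.
Proof.
move=> AB BC a [f fa]; have [b ab] := AB a (exposes_exposed fa).
have [c bc] := BC b (exposes_exposed (ab f fa)).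
by exists c => g ga; apply/bc/ab.
Qed.

Lemma refines_minkowskir A B C : refines A B -> refines A C ->
  refines A (minkowski B C).
Proof.
move=> AB AC a [f fa]; have [b ab] := AB a (exposes_exposed fa).
have [c ac] := AC a (exposes_exposed fa).
exists (b + c) => g ga; have gb := ab g ga; have gc := ac g ga.
by apply/exposes_minkowski; [case: gb|case: gc|].
Qed.

Lemma refines_minkowskil A B C : refines A B -> refines (minkowski A C) B.
Proof.
move=> AB v [f fv]; have [a Aa [c Cc vE]] := fv.1.
have fa : exposes f A a by have [] := (exposes_minkowski f Aa Cc).1; rewrite ?vE.
have [b ab] := AB a (exposes_exposed fa); exists b => g; rewrite -vE.
by move=> /(exposes_minkowski g Aa Cc)[/ab].
Qed.

Lemma exposes_mulmx f M A a : injective (mulmx M : 'cV[R]_n -> 'cV[R]_n) ->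
  exposes f (mulmx M @` A) (M *m a) <-> exposes (f *m M) A a.
Proof.
move=> Minj; split=> [[[b Ab /Minj <-] fb]|[Aa fa]]; split=> //.
- move=> x Ax xb; rewrite !dot_mulmx; apply: fb; first by exists x.
  by move=> Mxb; apply/xb/Minj.
- move=> _ [x Ax <-] xa; rewrite -!dot_mulmx; apply: fa => // xaE.
  by apply: xa; rewrite xaE.
Qed.

Lemma refines_mulmx M A B : M \in unitmx -> refines A B ->
  refines (mulmx M @` A) (mulmx M @` B).
Proof.
move=> Mu AB v [f fv]; have [a Aa aE] := fv.1; rewrite -aE in fv *.
have Minj : injective (mulmx M : 'cV[R]_n -> 'cV[R]_n).
  by apply: can_inj (mulmx (invmx M)) _ => x; rewrite mulKmx.
have [b ab] := AB a (exposes_exposed ((exposes_mulmx _ _ _ Minj).1 fv)).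
exists (M *m b) => g /(exposes_mulmx _ _ _ Minj) /ab.
by move=> /(exposes_mulmx _ _ _ Minj).
Qed.

(** An exposed point of [A + B] determines its summands, since any functional
    exposing it exposes both of them. *)
Definition left_summand A B v : 'cV[R]_n :=
  xget 0 [set a | A a /\ exists2 b, B b & a + b = v].

Lemma left_summandP A B a b : A a -> B b -> exposed (minkowski A B) (a + b) ->
  left_summand A B (a + b) = a.
Proof.
move=> Aa Bb [f fab]; apply: xget_unique; first by split=> //; exists b.
move=> x [Ax [y By xyE]]; rewrite -xyE in fab.
have [fx _] := (exposes_minkowski f Ax By).1 fab.
rewrite xyE in fab; have [fa _] := (exposes_minkowski f Aa Bb).1 fab.
exact: exposes_unique fx fa.
Qed.

Lemma exposed_extends f A B a s : finite_set A -> finite_set B -> B !=set0 ->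
  exposes f A a -> (forall w, w \in s -> 0 < dot f w) ->
  exists2 g, forall w, w \in s -> 0 < dot g w &
    exposes g A a /\ exists b, exposes g B b.
Proof.
move=> /finite_seqP[r rA] fB B0 fa fs.
pose s' := s ++ [seq a - x | x <- r & x != a].
have [|g gs' [b gb]] := expose_nearby (f := f) (s := s') _ fB B0.
  move=> w; rewrite mem_cat => /orP[/fs //|/mapP[x + ->]].
  rewrite mem_filter dotBr subr_gt0 => /andP[/eqP xa xr].
  by apply: fa.2; rewrite // rA.
exists g => [w ws|]; first by apply: gs'; rewrite mem_cat ws.
split; last by exists b.
split; first by case: fa.
move=> x; rewrite rA /= => xr /eqP xa; rewrite -subr_gt0 -dotBr.
apply: gs'; rewrite mem_cat; apply/orP; right; apply/mapP.
by exists x; rewrite // mem_filter xa.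
Qed.

Lemma left_summand_image A B : finite_set A -> finite_set B -> B !=set0 ->
  left_summand A B @` exposed (minkowski A B) = exposed A.
Proof.
move=> fA fB B0; apply/seteqP; split=> [_ [v [f fv] <-]|a [f fa]].
  have [a Aa [b Bb vE]] := fv.1; subst v.
  rewrite left_summandP //; last by exists f.
  by exists f; have [] := (exposes_minkowski f Aa Bb).1 fv.
have [//|g _ [ga [b gb]]] := exposed_extends (s := [::]) fA fB B0 fa.
have gab : exposes g (minkowski A B) (a + b).
  by apply/exposes_minkowski; [case: ga|case: gb|].
exists (a + b); first by exists g.
by apply: left_summandP; [case: ga|case: gb|exists g].
Qed.

Lemma refines_left_summand_inj A B : finite_set A -> finite_set B -> B !=set0 ->
  refines A B <-> {in exposed (minkowski A B) &, injective (left_summand A B)}.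
Proof.
move=> fA fB B0; split=> [AB v w|inj a [f fa]].
  rewrite !inE => [[f fv] [g gw]].
  have [a Aa [b Bb vE]] := fv.1; have [c Ac [d Bd wE]] := gw.1.
  subst v w.
  rewrite !left_summandP //; [|by exists g|by exists f] => ac.
  rewrite -ac in Ac gw *; congr (_ + _).
  have [fa fb] := (exposes_minkowski f Aa Bb).1 fv.
  have [ga gd] := (exposes_minkowski g Aa Bd).1 gw.
  have [e ae] := AB a (exposes_exposed fa).
  by rewrite -(exposes_unique (ae f fa) fb) -(exposes_unique (ae g ga) gd).
have [//|g _ [ga [b gb]]] := exposed_extends (s := [::]) fA fB B0 fa.
have same h d : exposes h A a -> exposes h B d -> d = b.
  move=> ha hd; have [Aa Bb Bd] : [/\ A a, B b & B d].
    by case: ha; case: gb; case: hd.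
  have gab : exposed (minkowski A B) (a + b).
    by exists g; apply/exposes_minkowski.
  have had : exposed (minkowski A B) (a + d).
    by exists h; apply/exposes_minkowski.
  apply: (addrI a); apply: inj; rewrite ?inE //.
  by rewrite !left_summandP.
exists b => h ha; split; first by case: gb.
move=> x Bx xb; rewrite ltNge; apply/negP => hbx.
(* If [h] does not prefer [b] to [x], a small perturbation strictly prefers [x]
   to [b], so it exposes a point of [B] other than [b]. *)
have [k ka kxb] : exists2 k, exposes k A a & 0 < dot k (x - b).
  have [|u _ uxb] := @dot_separates_line _ _ 0 (x - b).
    by case=> t; rewrite scaler0 => /eqP; rewrite subr_eq0 => /eqP.
  have /finite_seqP[r rA] := fA.
  have [|e e0 es] := @positivity_stable _ _ [seq a - y | y <- r & y != a] h u.
    move=> w /mapP[y + ->]; rewrite mem_filter dotBr subr_gt0 => /andP[/eqP ya yr].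
    by apply: ha.2; rewrite // rA.
  exists (h + e *: u); last first.
    by rewrite dotDl dotZl ltr_wpDl ?mulr_gt0 // dotBr subr_ge0.
  split; first by case: ha.
  move=> y; rewrite rA /= => yr /eqP ya; rewrite -subr_gt0 -dotBr.
  by apply: (es e) => //; apply/mapP; exists y; rewrite // mem_filter ya.
have [|l lxb [la [d ld]]] := exposed_extends (s := [:: x - b]) fA fB B0 ka.
  by move=> w; rewrite inE => /eqP ->.
have db := same l d la ld; rewrite db in ld.
have := lxb (x - b); rewrite mem_head => /(_ isT).
by rewrite dotBr subr_gt0 ltNge (exposes_le ld Bx).
Qed.

End MinkowskiSums.

Lemma card_eq_image_inj (S U : choiceType) (X : set S) (p : S -> U) :
  finite_set X -> p @` X #= X <-> {in X &, injective p}.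
Proof.
move=> fX; split=> [/(fcard_eq (finite_image p fX) fX)|]; last exact: inj_card_eq.
rewrite fset_set_image // => /eqP/card_in_imfsetP pinj x y.
by rewrite -!in_fset_set //; exact: pinj.
Qed.

(** Each vertex of the sum extends a vertex of the first summand, in one way only
    when the second summand adds no new wall to the normal fan. *)
Lemma refines_card (R : realType) (n : nat) (A B : set 'cV[R]_n) :
  finite_set A -> finite_set B -> B !=set0 ->
  refines A B <-> exposed A #= exposed (minkowski A B).
Proof.
move=> fA fB B0; rewrite refines_left_summand_inj // -(left_summand_image fA fB B0).
by rewrite card_eq_image_inj //; exact/finite_exposed/finite_minkowski.
Qed.

(** * Digit sums and the self-affine set *)

Section DigitSums.
Context {R : realType} {n : nat}.
Implicit Types (T M : 'M[R]_n) (A B C D F : set 'cV[R]_n).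

Lemma minkowskiA A B C :
  minkowski A (minkowski B C) = minkowski (minkowski A B) C.
Proof.
apply/seteqP; split=> [_ [a Aa [_ [b Bb [c Cc <-]] <-]]|
                       _ [_ [a Aa [b Bb <-]] [c Cc <-]]].
  by exists (a + b); [exists a => //; exists b|exists c; rewrite ?addrA].
by exists a => //; exists (b + c); [exists b => //; exists c|rewrite addrA].
Qed.

Lemma mulmx_minkowski M A B :
  mulmx M @` minkowski A B = minkowski (mulmx M @` A) (mulmx M @` B).
Proof.
apply/seteqP; split=> [_ [_ [a Aa [b Bb <-]] <-]|_ [_ [a Aa <-] [_ [b Bb <-] <-]]].
  by exists (M *m a); [exists a|exists (M *m b); [exists b|rewrite mulmxDr]].
by exists (a + b); [exists a => //; exists b|rewrite mulmxDr].
Qed.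

Lemma mulmx_image_exprS T i A :
  mulmx (T ^+ i.+1) @` A = mulmx T @` (mulmx (T ^+ i) @` A).
Proof.
rewrite image_comp; apply: eq_imagel => x _ /=.
by rewrite exprS -mulmxE mulmxA.
Qed.

Lemma mulmx_image_exprSr T i A :
  mulmx (T ^+ i.+1) @` A = mulmx (T ^+ i) @` (mulmx T @` A).
Proof.
rewrite image_comp; apply: eq_imagel => x _ /=.
by rewrite exprSr -mulmxE mulmxA.
Qed.

Lemma minkowski0 A : minkowski [set 0] A = A.
Proof.
apply/seteqP; split=> [_ [_ -> [a Aa <-]]|a Aa]; first by rewrite add0r.
by exists 0 => //; exists a => //; rewrite add0r.
Qed.

Lemma digit_sums0 T D : D !=set0 -> digit_sums T D 0 = [set 0].
Proof.
move=> [d Dd]; apply/seteqP; split=> [_ [e _ ->]|_ ->].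
  by rewrite big_geq.
by exists (fun=> d) => //; rewrite big_geq.
Qed.

Lemma digit_sumsS T D i :
  digit_sums T D i.+1 = minkowski (digit_sums T D i) (mulmx (T ^+ i.+1) @` D).
Proof.
apply/seteqP; split=> [_ [d Dd ->]|_ [_ [d Dd ->] [_ [e De <-] <-]]].
  rewrite big_nat_recr //=; exists (\sum_(1 <= s < i.+1) T ^+ s *m d s).
    by exists d.
  by exists (T ^+ i.+1 *m d i.+1) => //; exists (d i.+1).
exists (fun s => if s == i.+1 then e else d s) => [s|]; first by case: ifP.
rewrite [RHS]big_nat_recr //= eqxx; congr (_ + _).
by apply: eq_big_nat => s /andP[_ si]; rewrite ltn_eqF.
Qed.

Lemma digit_sumsS_mulmx T D i : D !=set0 -> digit_sums T D i.+1 =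
  minkowski (mulmx T @` D) (mulmx T @` digit_sums T D i).
Proof.
move=> D0; elim: i => [|i IH].
  rewrite digit_sumsS digit_sums0 // minkowskiC image_set1 mulmx0 minkowskiC.
  by rewrite minkowskiC expr1.
rewrite digit_sumsS {1}IH mulmx_image_exprS -minkowskiA; congr minkowski.
by rewrite -mulmx_minkowski -digit_sumsS.
Qed.

Lemma finite_digit_sums T D i : finite_set D -> D !=set0 ->
  finite_set (digit_sums T D i).
Proof.
move=> fD D0; elim: i => [|i IH]; first by rewrite digit_sums0.
by rewrite digit_sumsS; apply/finite_minkowski/finite_image.
Qed.

Lemma digit_sums_neq0 T D i : D !=set0 -> digit_sums T D i !=set0.
Proof.
by move=> [d Dd]; exists (\sum_(1 <= s < i.+1) T ^+ s *m d); exists (fun=> d).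
Qed.

(** Multiplication by [T] carries the refinement at step [i] to [T A_i], which is
    a summand of [A_(i+1)]. *)
Lemma digit_sums_refines T D i j : T \in unitmx -> D !=set0 -> (i <= j)%N ->
  refines (digit_sums T D i) (mulmx (T ^+ i.+1) @` D) ->
  refines (digit_sums T D j) (mulmx (T ^+ j.+1) @` D).
Proof.
move=> Tu D0 /subnK <-; elim: (j - i)%N => // k IH /IH {}IH.
rewrite addSn digit_sumsS_mulmx // mulmx_image_exprS minkowskiC.
exact/refines_minkowskil/refines_mulmx.
Qed.

Lemma digit_sums_stable T D i j : T \in unitmx -> D !=set0 -> (i <= j)%N ->
  refines (digit_sums T D i) (mulmx (T ^+ i.+1) @` D) ->
  refines (digit_sums T D i) (digit_sums T D j).
Proof.
move=> Tu D0 /subnK <- Ti; elim: (j - i)%N => [|k IH]; first exact: refines_refl.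
rewrite addSn digit_sumsS; apply: refines_minkowskir => //.
by apply: refines_trans IH _; apply: digit_sums_refines Ti => //; rewrite leq_addl.
Qed.

Lemma self_affine_expansion T D F j : D !=set0 ->
  F = \bigcup_(d in D) [set T *m (x + d) | x in F] ->
  F = minkowski (digit_sums T D j) (mulmx (T ^+ j) @` F).
Proof.
move=> D0 FE.
have F1 : F = minkowski (mulmx T @` D) (mulmx T @` F).
  rewrite {1}FE; apply/seteqP; split=> [_ [d Dd [x Fx <-]]|].
    exists (T *m d); first by exists d.
    by exists (T *m x); [exists x|rewrite addrC mulmxDr].
  move=> _ [_ [d Dd <-] [_ [x Fx <-] <-]]; exists d => //; exists x => //.
  by rewrite addrC mulmxDr.
elim: j => [|j IH].
  rewrite digit_sums0 // minkowski0 -[LHS]image_id; apply: eq_imagel => x _.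
  by rewrite expr0 mul1mx.
rewrite {1}IH {1}F1 mulmx_minkowski -!mulmx_image_exprSr minkowskiA.
by rewrite -digit_sumsS.
Qed.

End DigitSums.

(** * Powers of a contracting matrix *)

(** Splitting off one root [a] makes [M ^+ j * X] a solution of a recurrence
    [x_(j+1) = a x_j + y_j], where the [y_j] are bounded by induction. As [a] is
    smaller than [r], the solution is again of the order of [r ^+ j]. *)
Lemma annihilated_power_bound (K : numFieldType) n (M : 'M[K]_n.+1) (s : seq K)
    (q r : K) (X : 'M[K]_n.+1) : 0 <= q -> q < r -> (forall a, a \in s -> `|a| <= q) ->
  horner_mx M (\prod_(a <- s) ('X - a%:P)) * X = 0 ->
  exists2 C, 0 <= C & forall j i k, `|(M ^+ j * X) i k| <= C * r ^+ j.
Proof.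
move=> q0 qr; have r0 : 0 < r := le_lt_trans q0 qr.
elim: s X => [|a s IH] X sq.
  rewrite big_nil rmorph1 mul1r => ->; exists 0 => // j i k.
  by rewrite mulr0 mxE normr0 mul0r.
rewrite big_cons mulrC rmorphM -mulrA => XE.
have [|C' C'0 YC] := IH _ _ XE; first by move=> b bs; apply: sq; rewrite inE bs orbT.
have aq : `|a| <= q by apply: sq; rewrite mem_head.
set Y := _ * X in XE YC.
have YE j : M ^+ j.+1 * X = a *: (M ^+ j * X) + M ^+ j * Y.
  rewrite /Y rmorphB /= horner_mx_X horner_mx_C mulrBl mulrBr.
  rewrite -[a%:M * X]/(a%:M *m X) mul_scalar_mx -scalerAr addrC subrK.
  by rewrite exprSr -mulrA.
have rq : 0 < r - q by rewrite subr_gt0.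
pose B := \sum_i \sum_k `|X i k|.
have B0 : 0 <= B by apply: sumr_ge0 => i _; exact: sumr_ge0.
have XB i k : `|X i k| <= B.
  rewrite /B (bigD1 i) //= (bigD1 k) //= -addrA lerDl addr_ge0 //.
    exact: sumr_ge0.
  by apply: sumr_ge0 => l _; exact: sumr_ge0.
exists (B + C' / (r - q)); first by rewrite addr_ge0 // divr_ge0 // ltW.
move=> j i k; elim: j => [|j IHj].
  rewrite !expr0 mul1r mulr1 (le_trans (XB i k)) // lerDl divr_ge0 //.
  exact: ltW.
set C := B + _ in IHj *.
rewrite YE mxE [X in X + _]mxE; apply: le_trans (ler_normD _ _) _; rewrite normrM.
have -> : C * r ^+ j.+1 = q * (C * r ^+ j) + (C * (r - q)) * r ^+ j.
  by rewrite exprS; ring.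
apply: lerD.
  exact: ler_pM.
apply: le_trans (YC j i k) _; rewrite ler_wpM2r ?exprn_ge0 ?(ltW r0) //.
by rewrite /C mulrDl divfK ?gt_eqF // lerDr mulr_ge0 // ltW.
Qed.

Lemma contracting_power_bound (R : realType) n (T : 'M[R]_n) :
  (forall a : R[i], complex_eigenvalues T a -> `|a| < 1) ->
  exists C r : R, [/\ 0 <= C, 0 <= r, r < 1 &
    forall j i k, `|(T ^+ j) i k| <= C * r ^+ j].
Proof.
case: n T => [|n] T Tc; first by exists 0, 0; split=> // j [].
pose M := map_mx (real_complex R) T.
have [s sE] := closed_field_poly_normal (char_poly M).
rewrite (monicP (char_poly_monic M)) scale1r in sE.
have s1 a : a \in s -> `|a| < 1.
  move=> sa; apply: Tc; rewrite /complex_eigenvalues /= eigenvalue_root_char.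
  by rewrite sE root_prod_XsubC.
have [q q0 [q1 sq]] : exists2 q : R, 0 <= q & q < 1 /\
    forall a, a \in s -> `|a| <= q%:C.
  elim: s s1 {sE} => [|a s IH] s1; first by exists 0.
  have [|q q0 [q1 sq]] := IH; first by move=> b bs; apply: s1; rewrite inE bs orbT.
  have aE : `|a| = (complex.Re `|a|)%:C by rewrite normc_def.
  have := s1 a (mem_head _ _); rewrite aE ltcR => a1.
  exists (Num.max q (complex.Re `|a|)); first by rewrite le_max q0.
  split; first by rewrite gt_max q1.
  move=> b; rewrite inE => /predU1P[->|/sq bq].
    by rewrite aE lecR le_max lexx orbT.
  by rewrite (le_trans bq) // lecR le_max lexx.
pose r := (1 + q) / 2.
have [r0 qr r1] : [/\ 0 <= r, q < r & r < 1] by rewrite /r; clear -q0 q1; split; lra.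
have [|||C C0 MC] := @annihilated_power_bound _ _ M s q%:C r%:C 1 _ _ sq.
- by rewrite lecR.
- by rewrite ltcR.
- by rewrite -sE Cayley_Hamilton mul0r.
exists (complex.Re C), r; split=> //.
  by move: C0; rewrite lecE => /andP[].
move=> j i k; have := MC j i k.
have -> : C = (complex.Re C)%:C by apply/eqP; rewrite eq_complex /= ger0_Im // !eqxx.
rewrite mulr1 -!rmorphXn mxE normc_def -rmorphM lecR /= expr0n addr0.
by rewrite sqrtr_sqr.
Qed.

(** * Stable vertices yield a polytope *)

Section StableHull.
Context {R : realType} {n : nat}.
Implicit Types (T : 'M[R]_n) (D F : set 'cV[R]_n).

Lemma dot_continuous (f : 'rV[R]_n) : continuous (dot f : 'cV[R]_n -> R).
Proof.
rewrite (_ : dot f = fun x => \sum_i f 0 i * x i 0); last first.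
  by apply/funext => x; rewrite /dot mxE.
apply: (continuous_big add_continuous) => i _ x.
apply: (@continuousM R _ (cst (f 0 i)) (fun y : 'cV[R]_n => y i 0) x).
  exact: cst_continuous.
exact: coord_continuous.
Qed.

Lemma contracting_tail T F (f : 'rV[R]_n) (e : R) :
  (forall a : R[i], complex_eigenvalues T a -> `|a| < 1) -> compact F -> 0 < e ->
  \forall j \near \oo, forall x, F x -> `|dot f (T ^+ j *m x)| < e.
Proof.
move=> Tc Fc e0; have [C [r [C0 r0 r1 TC]]] := contracting_power_bound Tc.
have [B B0 FB] : exists2 B : R, 0 <= B & forall x, F x -> forall i, `|x i 0| <= B.
  have [B [_ FB]] := compact_bounded Fc.
  exists (`|B| + 1); first by rewrite addr_ge0.
  move=> x Fx i; apply: le_trans (FB _ _ x Fx).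
    by rewrite [X in _ <= X]mx_normrE; apply: (le_bigmax _ _ (i, 0)).
  by rewrite (le_lt_trans (ler_norm B)) // ltrDl.
pose S := (\sum_i `|f 0 i|) * (n%:R * B) * C.
have /cvgr0_norm_lt/(_ e e0) : geometric S r @ \oo --> 0.
  by apply: cvg_geometric; rewrite ger0_norm.
apply: filterS => j; rewrite ger0_norm; last first.
  by rewrite /geometric /= /S !mulr_ge0 // ?exprn_ge0 // sumr_ge0.
move=> Sj x Fx; apply: le_lt_trans Sj.
rewrite /dot mxE (le_trans (ler_norm_sum _ _ _)) // /geometric /= /S.
rewrite -mulrA -mulrA mulr_suml; apply: ler_sum => i _.
rewrite normrM ler_wpM2l // mxE (le_trans (ler_norm_sum _ _ _)) //.
rewrite -mulrA mulr_natl -[X in _ *+ X]card_ord -sumr_const mulr_suml.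
apply: ler_sum => k _.
by rewrite normrM mulrC ler_pM // FB.
Qed.

(** The hull of [F] is spanned by points [p a], one for each vertex [a] of the
    stable digit sum: [p a] is a cluster point of the points exposed in the later
    digit sums by the functionals that expose [a], so all these functionals are
    maximal on [F] at [p a]. Generic functionals expose some [a], hence none of
    them separates a point of [F] from the [p a]. *)
Theorem stable_hull_polytope T D F i : T \in unitmx ->
  (forall a : R[i], complex_eigenvalues T a -> `|a| < 1) ->
  finite_set D -> D !=set0 -> F !=set0 -> compact F ->
  F = \bigcup_(d in D) [set T *m (x + d) | x in F] ->
  refines (digit_sums T D i) (mulmx (T ^+ i.+1) @` D) ->
  polytope (convex_hull F).
Proof.
move=> Tu Tc fD D0 [x0 Fx0] Fc FE Ti.
have fA := finite_digit_sums T i fD D0.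
have FE' j : F = minkowski (digit_sums T D j) (mulmx (T ^+ j) @` F).
  exact: self_affine_expansion.
have [v vP] : exists v : 'cV[R]_n -> nat -> 'cV[R]_n, forall a j,
    exposed (digit_sums T D i) a -> (i <= j)%N ->
    forall f, exposes f (digit_sums T D i) a -> exposes f (digit_sums T D j) (v a j).
  have H a j : exists b, exposed (digit_sums T D i) a -> (i <= j)%N ->
      forall f, exposes f (digit_sums T D i) a -> exposes f (digit_sums T D j) b.
    have [aA|aA] := pselect (exposed (digit_sums T D i) a); last by exists 0.
    have [ij|] := boolP (i <= j)%N; last by exists 0.
    by have [b ab] := digit_sums_stable Tu D0 ij Ti aA; exists b.
  have [v vP] := choice (fun aj => H aj.1 aj.2).
  by exists (fun a j => v (a, j)) => a j; exact: vP (a, j).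
have [p pP] : exists p : 'cV[R]_n -> 'cV[R]_n, forall a,
    exposed (digit_sums T D i) a -> F (p a) /\
    forall f x, exposes f (digit_sums T D i) a -> F x -> dot f x <= dot f (p a).
  suff H a : exists q, exposed (digit_sums T D i) a -> F q /\
      forall f x, exposes f (digit_sums T D i) a -> F x -> dot f x <= dot f q.
    by have [p pP] := choice H; exists p.
  have [aA|aA] := pselect (exposed (digit_sums T D i) a); last by exists 0.
  (* The vanishing term puts the approximants inside the compact set [F]. *)
  pose y j := v a j + T ^+ j *m x0.
  have yF : (y @ \oo) F.
    exists i => // j /= ij; rewrite (FE' j).
    have [f fa] := aA; exists (v a j); first by have [] := vP a j aA ij f fa.
    by exists (T ^+ j *m x0) => //; exists x0.
  have [q [Fq qcl]] := Fc _ _ yF.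
  exists q => _; split=> // f x fa Fx; rewrite leNgt; apply/negP => qx.
  pose e := (dot f x - dot f q) / 3.
  have e0 : 0 < e by rewrite divr_gt0 // subr_gt0.
  have big : (y @ \oo) [set z | dot f x - (e + e) < dot f z].
    have [N _ NT] := contracting_tail f Tc Fc e0.
    exists (maxn i N) => // j /=; rewrite geq_max => /andP[ij Nj].
    have := Fx; rewrite {1}(FE' j) => -[b bA [_ [z Fz <-] <-]].
    have bv := exposes_le (vP a j aA ij f fa) bA.
    have := NT j Nj z Fz; have := NT j Nj x0 Fx0.
    rewrite /y !dotDr !ltr_norml => /andP[h1 h2] /andP[h3 h4].
    by clear -bv h1 h2 h3 h4; lra.
  have near_q : nbhs q [set z | dot f z < dot f q + e].
    apply: (@dot_continuous f q [set t | t < dot f q + e]).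
    by apply: lt_nbhsl; rewrite ltrDl.
  have [z [/= z1 z2]] := qcl _ _ big near_q.
  by move: z1 z2; rewrite /e; clear; lra.
pose P := p @` exposed (digit_sums T D i).
have fP : finite_set P by apply/finite_image/finite_exposed.
exists P => //; apply/seteqP; split; apply: convex_hull_sub;
  try exact: convex_hull_convex; last first.
  by move=> _ [a aA <-]; apply: sub_convex_hull; have [] := pP a aA.
move=> x Fx; apply: contrapT => xP.
have /finite_seqP[s sP] := fP.
have [f fs] : exists f, forall y, y \in s -> dot f y < dot f x.
  apply: separation (@convex_hull_convex _ _ P) _ xP => y ys.
  by apply: sub_convex_hull; rewrite sP.
have [|g gs [a ga]] := expose_nearby (f := f) (s := [seq x - y | y <- s]) _ fA
    (digit_sums_neq0 T i D0).
  by move=> _ /mapP[y ys ->]; rewrite dotBr subr_gt0 fs.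
have [_ /(_ g x ga Fx)] := pP a (exposes_exposed ga).
apply/negP; rewrite -ltNge -subr_gt0 -dotBr; apply/gs/map_f.
have : P (p a) by exists a => //; exists g.
by rewrite sP.
Qed.

End StableHull.

(** * Periodic directions *)

Lemma uniq_roots_XnsubC (K : numClosedFieldType) (p : nat) (c : K) (s : seq K) :
  (0 < p)%N -> c != 0 -> 'X^p - c%:P = \prod_(a <- s) ('X - a%:P) -> uniq s.
Proof.
move=> p0 c0 sE; rewrite -separable_prod_XsubC -sE separable_poly.unlock.
have pK : (p%:R : K) != 0 by rewrite pnatr_eq0 -lt0n.
(* With [P = 'X^p - c], one has [P - p^-1 'X P' = - c]. *)
apply/Bezout_coprimepP; exists (1, - (p%:R^-1)%:P * 'X) => /=.
rewrite derivB derivC subr0 derivXn mul1r !mulNr -mulrA mulrnAr -exprS prednK //.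
have -> : (p%:R^-1)%:P * ('X^p *+ p) = 'X^p :> {poly K}.
  by rewrite mulrnAr -mulrnAl -polyCMn -[_ *+ p]mulr_natr mulVf ?mul1r.
rewrite addrAC subrr add0r.
by rewrite -polyCN polyC_eqp1 oppr_eq0.
Qed.

(** The factors whose roots are not eigenvalues are invertible and can be dropped
    from a product annihilating [v]. *)
Lemma horner_mx_eigenvalues (K : fieldType) n (M : 'M[K]_n.+1) (s : seq K)
    (v : 'cV[K]_n.+1) :
  horner_mx M (\prod_(a <- s) ('X - a%:P)) *m v = 0 ->
  horner_mx M (\prod_(a <- s | eigenvalue M a) ('X - a%:P)) *m v = 0.
Proof.
rewrite (bigID (eigenvalue M)) /= mulrC rmorphM /= -mulmxE -mulmxA.
set w := horner_mx M _ *m v; set N := horner_mx M _ => Nw.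
have Nu : N \in unitmx.
  rewrite /N rmorph_prod; apply: (big_ind (fun A => A \in unitmx)).
  - exact: unitmx1.
  - by move=> A B Au Bu; rewrite unitmx_mul Au.
  move=> a; rewrite rmorphB /= horner_mx_X horner_mx_C /eigenvalue negbK.
  by rewrite /eigenspace kermx_eq0 row_free_unit.
by rewrite -(mulKmx Nu w) Nw mulmx0.
Qed.

(** A direction that [T] maps to itself after some number of steps is a sum of
    eigenvectors of [W], the inverse of [T], whose eigenvalues all have the same
    modulus and a rational angle. The exponent [k] kills all those angles at
    once, so that [W ^ k] acts on the direction as the [k]-th power of the
    common modulus. *)
Lemma periodic_direction (R : realType) n (T : 'M[R]_n) (m : nat) (c : 'I_m -> R)
    (N : 'I_m -> nat) (z : 'I_m -> R[i]) (k p : nat) (u : 'cV[R]_n) (l : R) :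
  T \in unitmx -> (forall i, 0 < c i) -> (forall i, (0 < N i)%N) ->
  (forall i, z i ^+ (2 * N i) = 1) ->
  rational_angle_eigenvalues (invmx T) = [set (c i)%:C * z i | i in [set: 'I_m]] ->
  k = (2 * \prod_(i < m) N i)%N ->
  u != 0 -> (0 < p)%N -> l != 0 -> T ^+ p *m u = l *: u ->
  exists2 r, 0 < r & T ^+ k *m u = r *: u.
Proof.
case: n T u => [|n] T u Tu c0 N0 zN UE kE u0 p0 l0 Tpu.
  by case/eqP: u0; apply/colP => -[].
pose W := invmx T.
have WT1 : W * T = 1 by rewrite -mulmxE mulVmx.
have TW1 : T * W = 1 by rewrite -mulmxE mulmxV.
have cWT : GRing.comm W T by rewrite /GRing.comm WT1 TW1.
have WT j : W ^+ j *m (T ^+ j *m u) = u.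
  by rewrite mulmxA mulmxE -exprMn_comm // WT1 expr1n; exact: mul1mx.
have TW j : T ^+ j *m (W ^+ j *m u) = u.
  rewrite mulmxA mulmxE -exprMn_comm ?TW1 ?expr1n; first exact: mul1mx.
  exact: commr_sym.
have Wpu : W ^+ p *m u = l^-1 *: u.
  by rewrite -[in RHS](WT p) Tpu -scalemxAr scalerA mulVf ?scale1r.
pose M := map_mx (real_complex R) W; pose v := map_mx (real_complex R) u.
have v0 : v != 0 by rewrite map_mx_eq0.
have [s sE] := closed_field_poly_normal ('X^p - (l^-1%:C)%:P).
rewrite (monicP (monicXnsubC _ p0)) scale1r in sE.
have l1 : l^-1%:C != 0 by rewrite fmorph_eq0 invr_eq0.
have s_uniq := uniq_roots_XnsubC p0 l1 sE.
have sM : horner_mx M (\prod_(a <- s) ('X - a%:P)) *m v = 0.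
  rewrite -sE rmorphB rmorphXn /= horner_mx_X horner_mx_C mulmxBl -rmorphXn /=.
  by rewrite -map_mxM Wpu map_mxZ mul_scalar_mx subrr.
have := horner_mx_eigenvalues sM; rewrite -big_filter.
set s' := [seq _ <- _ | _] => s'M.
have s'P a : a \in s' -> a ^+ p = l^-1%:C /\ a ^+ k = `|a| ^+ k.
  rewrite mem_filter => /andP[Ma sa].
  have ap : a ^+ p = l^-1%:C.
    apply/eqP; rewrite -subr_eq0.
    have : root ('X^p - (l^-1%:C)%:P) a by rewrite sE root_prod_XsubC.
    by rewrite /root !hornerE.
  split=> //; have a0 : a != 0.
    by apply: contra_neq l1 => aE; rewrite -ap aE expr0n gtn_eqF.
  have aE : `|a| = (complex.Re `|a|)%:C by rewrite normc_def.
  have : rational_angle_eigenvalues W a.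
    split=> //; exists (complex.Re `|a|), (a / `|a|); split.
    - by rewrite -ltcR -aE normr_gt0.
    (* [a ^+ p] is real of either sign, so only the square of [(a / |a|) ^+ p]
       is sure to be [1]. *)
    - exists (2 * p)%N; first by rewrite muln_gt0.
      rewrite mulnC exprM expr_div_n -normrX ap expr_div_n real_normK ?divff //.
        by rewrite expf_neq0.
      by apply/complex_realP; exists l^-1.
    - by rewrite -aE mulrCA divff ?mulr1 // normr_eq0.
  rewrite UE => -[i _ <-].
  have z1 : `|z i| = 1.
    have N2 : (0 < 2 * N i)%N by rewrite muln_gt0 N0.
    by apply/eqP; rewrite -(pexpr_eq1 N2) // -normrX zN normr1.
  have zk : z i ^+ k = 1.
    by rewrite kE (bigD1 i) //= mulnA exprM zN expr1n.
  rewrite normrM z1 mulr1 normc_def /= expr0n addr0 sqrtr_sqr gtr0_norm //.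
  by rewrite exprMn zk mulr1.
have [a s'a] : exists a, a \in s'.
  move: s'M; case: s' {s'P} => [|a s'']; last by exists a; rewrite mem_head.
  by rewrite big_nil rmorph1 mul1mx => /eqP; rewrite (negPf v0).
have [ap ak] := s'P a s'a.
have a0 : a != 0.
  by apply: contra_neq l1 => aE; rewrite -ap aE expr0n gtn_eqF.
have aE : `|a| = (complex.Re `|a|)%:C by rewrite normc_def.
set r := complex.Re `|a| in aE.
have r0 : 0 < r by rewrite -ltcR -aE normr_gt0.
have [q qE] : exists q, 'X^k - (r ^+ k)%:C%:P = q * \prod_(b <- s') ('X - b%:P).
  apply/dvdpP/uniq_roots_dvdp; last by rewrite uniq_rootsE filter_uniq.
  apply/allP => b /s'P[bp bk]; rewrite /root !hornerE bk.
  suff -> : `|b| = `|a| by rewrite aE -rmorphXn subrr.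
  by apply/eqP; rewrite -(eqrXn2 p0) // -!normrX bp ap.
have Mk : M ^+ k *m v = (r ^+ k)%:C *: v.
  apply/eqP; rewrite -subr_eq0 -mul_scalar_mx -mulmxBl.
  have -> : M ^+ k - (r ^+ k)%:C%:M = horner_mx M ('X^k - (r ^+ k)%:C%:P).
    by rewrite rmorphB /= (rmorphXn (horner_mx M)) /= horner_mx_X horner_mx_C.
  by rewrite qE rmorphM -mulmxE -mulmxA s'M mulmx0.
have Wk : W ^+ k *m u = r ^+ k *: u.
  apply: (@map_mx_inj _ _ (real_complex R)).
  by rewrite map_mxM map_mxZ rmorphXn.
exists (r ^+ k)^-1; first by rewrite invr_gt0 exprn_gt0.
by rewrite -[in RHS](TW k) Wk -scalemxAr scalerA mulVf ?scale1r // expf_neq0 // gt_eqF.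
Qed.

(** * Edges of a summand *)

Section Edges.
Context {R : realType} {n : nat}.
Implicit Types (M : 'M[R]_n) (f g : 'rV[R]_n) (a b x y u : 'cV[R]_n).
Implicit Types A C D S : set 'cV[R]_n.

(** Perturb the functional supporting the edge [a, b] of [A] so that it separates
    any two points of [S] whose difference is not parallel to [a - b]. Its maximal
    set in the sum still contains a translate of [a, b], so it has at least two
    maximal points in [S]. *)
Lemma edge_of_summand f A C S a b : finite_set A -> finite_set S ->
  C !=set0 -> convex_hull (minkowski A C) = convex_hull S -> A a -> A b -> a <> b ->
  dot f (a - b) = 0 ->
  (forall d, A d -> 0 < dot f (a - d) \/ exists t, a - d = t *: (a - b)) ->
  exists x y, [/\ S x, S y, x <> y & exists t, x - y = t *: (a - b)].
Proof.
move=> /finite_seqP[r rA] /finite_seqP[s sS] [c Cc] SE Aa Ab ab fab fA.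
have [|g [gab gr gs]] := generic_functional
    (s := [seq x <- [seq a - d | d <- r] | 0 < dot f x])
    [seq x - y | x <- s, y <- s] fab.
  by move=> w; rewrite mem_filter => /andP[].
have gA d : A d -> dot g d <= dot g a.
  move=> Ad; rewrite -subr_ge0 -dotBr.
  have [fad|[t ->]] := fA d Ad; last by rewrite dotZr gab mulr0.
  apply/ltW/gr; rewrite mem_filter fad /=.
  by apply/mapP; exists d => //; rewrite rA in Ad.
have hull_sub y : minkowski A C y -> convex_hull S y.
  by move=> Hy; rewrite -SE; exact: sub_convex_hull.
have [|x xs xmax] := argmax_dot g (s := s).
  apply/eqP => s0; have : convex_hull S (a + c).
    by apply: hull_sub; exists a => //; exists c.
  apply: (@convex_hull_sub _ _ _ set0); last by rewrite sS s0.
  by apply/convex_setP.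
have Sx : S x by rewrite sS.
have xmax' y : minkowski A C y -> dot g y <= dot g x.
  move=> /hull_sub; apply: convex_hull_le => w; rewrite sS; exact: xmax.
have [_ [d Ad [e Ce <-]] yx] : exists2 y, minkowski A C y & dot g y = dot g x.
  apply: contrapT => noy.
  have : convex_hull (minkowski A C) x by rewrite SE; exact: sub_convex_hull.
  suff /(_ x) H : convex_hull (minkowski A C) `<=` [set y | dot g y < dot g x].
    by move=> /H /=; rewrite ltxx.
  apply: convex_hull_sub => [|y Hy /=]; last first.
    rewrite lt_neqAle xmax' // andbT; apply/eqP => yx; apply: noy.
    by exists y.
  apply/convex_setP => y w t /= ylt wlt t0 t1; rewrite !dotE.
  by have [->|tN0] := eqVneq t 0; [lra|have {}t0 : 0 < t by rewrite lt_def tN0]; nra.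
have ACa : minkowski A C (a + e) by exists a => //; exists e.
have ACb : minkowski A C (b + e) by exists b => //; exists e.
have gae : dot g (a + e) = dot g x.
  apply/eqP; rewrite eq_le xmax' //= -yx !dotDr lerD2r; exact: gA.
have gbe : dot g (b + e) = dot g x.
  by rewrite -gae !dotDr; move: gab; rewrite dotBr => /subr0_eq ->.
have [y Sy [yNx gyx]] : exists2 y, S y & y <> x /\ dot g x <= dot g y.
  apply: contrapT => noy.
  have gx : exposes g S x.
    split=> // y Sy yNx; rewrite ltNge; apply/negP => gyx.
    by apply: noy; exists y.
  have at_x w : minkowski A C w -> dot g w = dot g x -> w = x.
    move=> Hw gw; apply: contrapT => /(convex_hull_exposes gx (hull_sub _ Hw)).
    by rewrite gw ltxx.
  by apply: ab; apply: (addIr e); rewrite (at_x _ ACa gae) (at_x _ ACb gbe).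
exists x, y; split=> //; first exact/nesym.
have [|/eqP gxy|//] := gs (x - y).
  by apply/allpairsP; exists (x, y); split=> //=; rewrite sS in Sy.
case: gxy; rewrite dotBr; apply/eqP; rewrite subr_eq0 eq_le gyx xmax //.
by rewrite sS in Sy.
Qed.

Lemma unitmx_exp M j : M \in unitmx -> M ^+ j \in unitmx.
Proof.
move=> Mu; elim: j => [|j IH]; first exact: unitmx1.
by rewrite exprS -mulmxE unitmx_mul Mu.
Qed.

(** By the pigeonhole principle two of the images of [u] are parallel to the same
    difference of points of [S], hence to each other. *)
Lemma finite_directions_periodic (T : 'M[R]_n) S u : T \in unitmx -> finite_set S ->
  (forall j, exists x y,
    [/\ S x, S y, x <> y & exists t, x - y = t *: (T ^+ j.+1 *m u)]) ->
  exists p l, [/\ (0 < p)%N, l != 0 & T ^+ p *m u = l *: u].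
Proof.
move=> Tu /finite_seqP[s ->] H.
have {}H j : exists xyt : 'cV[R]_n * 'cV[R]_n * R,
    [/\ xyt.1.1 \in s, xyt.1.2 \in s, xyt.1.1 <> xyt.1.2 &
     xyt.1.1 - xyt.1.2 = xyt.2 *: (T ^+ j.+1 *m u)].
  by have [x [y [xs ys xy [t tE]]]] := H j; exists (x, y, t).
have [h hP] := choice H.
pose L := [seq (x, y) | x <- s, y <- s].
have hL j : (h j).1 \in L.
  by have [h1 h2 _ _] := hP j; apply/allpairsP; exists (h j).1; split=> //; case: (h j) => [[]].
have /(uniqPn (h 0).1)[i [j [ij]]] : ~~ uniq [seq (h j).1 | j <- iota 0 (size L).+1].
  apply/negP => hu.
  suff : (size [seq (h j).1 | j <- iota 0 (size L).+1] <= size L)%N.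
    by rewrite size_map size_iota ltnn.
  by apply: uniq_leq_size hu _ => _ /mapP[j _ ->].
rewrite size_map size_iota => jL.
have iL := ltn_trans ij jL.
rewrite !(nth_map 0%N) ?size_iota // !nth_iota // !add0n => hij.
have [_ _ xy xyE] := hP i; have [_ _ _ xyE'] := hP j.
rewrite -hij xyE in xyE'.
set t := (h i).2 in xyE xyE'; set t' := (h j).2 in xyE'.
have t0 : t != 0.
  by apply/eqP => t0; apply/xy/subr0_eq; rewrite xyE t0 scale0r.
have t'0 : t' != 0.
  apply/eqP => t'0; apply/xy/subr0_eq.
  by rewrite xyE xyE' t'0 scale0r.
exists (j - i)%N, (t / t'); split; rewrite ?subn_gt0 //.
  by rewrite mulf_neq0 // invr_neq0.
have Tiu : T ^+ i.+1 \in unitmx by exact: unitmx_exp.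
apply: (can_inj (mulKmx Tiu)).
rewrite mulmxA mulmxE -exprD addSn subnKC ?(ltnW ij) // -scalemxAr.
by rewrite mulrC -scalerA xyE' scalerA mulVf ?scale1r.
Qed.

(** The assumption says that [M] multiplies by a positive number each edge [a - b]
    of [D]. The edges at a vertex [a] span the cone of [D] at [a], so [M] maps that
    cone onto itself and the normal cones of [D] at [a] and of the image of [D] at
    [M a] coincide. *)
Lemma refines_fixed_edges M D : finite_set D ->
  (forall a b f, D a -> D b -> a <> b -> dot f (a - b) = 0 ->
    (forall d, D d -> 0 < dot f (a - d) \/ exists t, a - d = t *: (a - b)) ->
    exists2 r, 0 < r & M *m (a - b) = r *: (a - b)) ->
  refines D (mulmx M @` D).
Proof.
move=> /finite_seqP[s sD] edges a [f fa].
pose L := [seq a - d | d <- s & d != a].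
have fL x : x \in L -> 0 < dot f x.
  move=> /mapP[d]; rewrite mem_filter => /andP[/eqP da ds ->].
  by rewrite dotBr subr_gt0; apply: fa.2; rewrite // sD.
have LD d : D d -> d <> a -> a - d \in L.
  move=> Dd /eqP da; apply/mapP; exists d => //.
  by rewrite mem_filter da; rewrite sD in Dd.
have [s' [s'L Ls' irr]] := irredundant_generators L.
have fixed u : u \in s' -> exists2 r, 0 < r & M *m u = r *: u.
  move=> us'; have [f0 f0u f0s'] := supporting_functional_of_ray
    (fun x xs' => fL x (s'L x xs')) us' (irr u us').
  have /mapP[b] := s'L u us'; rewrite mem_filter => /andP[/eqP ba bs uE].
  rewrite uE; apply: (edges a b f0); rewrite -?uE //.
  - by case: fa.
  - by rewrite sD.
  - exact/nesym.
  move=> d Dd; have [->|/eqP da] := eqVneq d a.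
    by right; exists 0; rewrite subrr scale0r.
  exact: f0s' (Ls' _ (mem_cone (LD d Dd da))).
exists (M *m a) => g ga; split; first by exists a => //; case: fa.
move=> _ [d Dd <-] MdNa; have da : d <> a by move=> da; apply: MdNa; rewrite da.
rewrite -subr_gt0 -dotBr -mulmxBr.
pose C x := x = 0 \/ 0 < dot g (M *m x).
have CC : is_cone C.
  split=> [|x y|c x c0]; first by left.
    move=> [->|gx] [->|gy]; rewrite ?add0r ?addr0; [by left|by right..|].
    by right; rewrite mulmxDr dotDr addr_gt0.
  have [->|cN0] := eqVneq c 0; first by left; rewrite scale0r.
  move=> [->|gx]; first by left; rewrite scaler0.
  by right; rewrite -scalemxAr dotZr mulr_gt0 // lt_def cN0.
have [||//] := cone_sub CC _ (Ls' _ (mem_cone (LD d Dd da))).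
  move=> u us'; right; have [r r0 ->] := fixed u us'; rewrite dotZr mulr_gt0 //.
  have /mapP[b] := s'L u us'; rewrite mem_filter => /andP[/eqP ba bs ->].
  by rewrite dotBr subr_gt0; apply: ga.2; rewrite // sD.
by move/subr0_eq/esym.
Qed.

End Edges.

(** * The characterization *)

(** Each image of an edge of [D] is an edge of a summand of the hull of [F], which
    makes the direction of the edge periodic under [T]; the assumption on [k] then
    applies to it. *)
Lemma polytope_refines (R : realType) (n : nat) (T : 'M[R]_n) (D F : set 'cV[R]_n)
    (k : nat) : T \in unitmx -> finite_set D -> D !=set0 -> F !=set0 ->
  F = \bigcup_(d in D) [set T *m (x + d) | x in F] -> (0 < k)%N ->
  (forall (p : nat) (l : R) (u : 'cV[R]_n), u != 0 -> (0 < p)%N -> l != 0 ->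
    T ^+ p *m u = l *: u -> exists2 r, 0 < r & T ^+ k *m u = r *: u) ->
  polytope (convex_hull F) ->
  refines (digit_sums T D k) (mulmx (T ^+ k.+1) @` D).
Proof.
move=> Tu fD D0 F0 FE k0 periodic [S fS SE].
suff DTk : refines D (mulmx (T ^+ k) @` D).
  case: k k0 DTk {periodic} => // k _ DTk.
  rewrite digit_sumsS_mulmx // mulmx_image_exprS.
  exact/refines_minkowskil/refines_mulmx.
apply: refines_fixed_edges => // a b f Da Db ab fab fD'.
have u0 : a - b != 0 by rewrite subr_eq0; apply/eqP.
suff [p [l [p0 l0 pl]]] : exists p l,
    [/\ (0 < p)%N, l != 0 & T ^+ p *m (a - b) = l *: (a - b)].
  exact: periodic pl.
apply: (finite_directions_periodic Tu fS) => j.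
have Tj : T ^+ j.+1 \in unitmx by exact: unitmx_exp.
have fT x : dot (f *m invmx (T ^+ j.+1)) (T ^+ j.+1 *m x) = dot f x.
  by rewrite dot_mulmx mulKmx.
pose C := minkowski (digit_sums T D j) (mulmx (T ^+ j.+1) @` F).
have [|||||||||x [y xyP]] := @edge_of_summand _ _ (f *m invmx (T ^+ j.+1))
    (mulmx (T ^+ j.+1) @` D) C S (T ^+ j.+1 *m a) (T ^+ j.+1 *m b).
- exact: finite_image.
- exact: fS.
- have [x Fx] := F0; have [s As] := digit_sums_neq0 T j D0.
  by exists (s + T ^+ j.+1 *m x); exists s => //; exists (T ^+ j.+1 *m x) => //; exists x.
- rewrite -SE /C minkowskiA [X in minkowski X _]minkowskiC -digit_sumsS.
  by rewrite -(self_affine_expansion j.+1 D0 FE).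
- by exists a.
- by exists b.
- by move=> /(can_inj (mulKmx Tj)).
- by rewrite -mulmxBr fT.
- move=> _ [d Dd <-]; rewrite -!mulmxBr fT.
  have [|[t ->]] := fD' d Dd; first by left.
  by right; exists t; rewrite scalemxAr.
by exists x, y; rewrite mulmxBr.
Qed.

Unset Implicit Arguments.

Theorem theorem3p1 (R : realType) (n : nat) (T : 'M[R]_n)
  (T_nonsingular : T \in unitmx)
  (T_contracting : forall a : R[i], complex_eigenvalues T a -> `|a| < 1)
  (D : set 'cV[R]_n) (D_finite : finite_set D) (D0 : D 0)
  (F : set 'cV[R]_n) (F_nonempty : F !=set0) (F_compact : compact F)
  (F_self_affine : F = \bigcup_(d in D) [set T *m (x + d) | x in F])
  (m : nat) (c : 'I_m -> R) (N : 'I_m -> nat) (z : 'I_m -> R[i])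
  (c_gt0 : forall l, 0 < c l) (N_gt0 : forall l, (0 < N l)%N)
  (z_unity : forall l, z l ^+ (2 * N l) = 1)
  (U_enum : rational_angle_eigenvalues (invmx T) =
            [set (c l)%:C * z l | l in [set: 'I_m]])
  (k : nat) (k_def : k = (2 * \prod_(l < m) N l)%N) :
  ((forall i : nat, (1 <= i <= k)%N ->
      ~ (hull_vertices T D i #= hull_vertices T D i.+1)) ->
   ~ polytope (convex_hull F)) /\
  (polytope (convex_hull F) <->
   exists2 i : nat, (1 <= i <= k)%N &
     hull_vertices T D i #= hull_vertices T D i.+1).
Proof.
have Dn0 : D !=set0 by exists 0.
have stableE i : refines (digit_sums T D i) (mulmx (T ^+ i.+1) @` D) <->
    hull_vertices T D i #= hull_vertices T D i.+1.
  have fA j : finite_set (digit_sums T D j) by exact: finite_digit_sums.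
  rewrite /hull_vertices !extreme_points_convex_hull // digit_sumsS.
  apply: refines_card => //; first exact: finite_image.
  by have [d Dd] := Dn0; exists (T ^+ i.+1 *m d); exists d.
have k0 : (0 < k)%N by rewrite k_def muln_gt0 prodn_gt0.
have toR : polytope (convex_hull F) -> exists2 i : nat, (1 <= i <= k)%N &
    hull_vertices T D i #= hull_vertices T D i.+1.
  move=> FP; exists k; first by rewrite k0 leqnn.
  apply/stableE; apply: polytope_refines F_self_affine k0 _ FP => // p l u.
  exact: periodic_direction U_enum k_def.
split; first by move=> noeq /toR[i ik]; exact: noeq.
split=> // -[i _ /stableE Ti].
exact: stable_hull_polytope F_self_affine Ti.
Qed.
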